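(* Let $(X,G)$ be a symmetric $G$-complete $G$-metric space and let $T:X\to X$ be an orbitally continuous mapping. Let $a_i:X\times X\times X\to[0,\infty)$, $i=1,\dots,7$, be functions, and let $0<\lambda_1<1$ be a real number such that $$a_1(x,y,z)+3a_2(x,y,z)+4a_3(x,y,z)+a_4(x,y,z)+a_6(x,y,z)\leq\lambda_1$$ for all $x,y,z\in X$. Suppose that, for all $x,y,z\in X$, writing $a_i=a_i(x,y,z)$, \begin{align*} G(Tx,Ty,Tz) \leq\ & a_1 G(x,y,z)+a_2[G(x,Tx,Tx)+G(y,Ty,Ty)+G(z,Tz,Tz)]\\ & + a_3[G(Tx,y,z)+G(x,Ty,z)+G(x,y,Tz)]\\ & + a_4\min\{G(y,Ty,Ty),G(z,Tz,Tz)\}\,\frac{1+G(x,Tx,Tx)}{1+G(x,y,z)}\\ & + a_5\, G(Tx,y,z)[1+G(x,Ty,z)+G(x,y,Tz)][1+G(x,y,z)]^{-1}\\ & + a_6\, G(x,y,z)[1+G(x,Tx,Tx)+G(Tx,y,z)][1+G(x,y,z)]^{-1}\\ & + a_7\, G(Tx,y,z). \end{align*} Then $T$ has at least one fixed point in $X$.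
   Context: A $G$-metric space $(X,G)$ is a nonempty set $X$ with a function $G:X\times X\times X\to[0,\infty)$ satisfying: (G1) $G(x,y,z)=0$ if $x=y=z$; (G2) $G(x,x,y)>0$ whenever $x\neq y$; (G3) $G(x,x,y)\leq G(x,y,z)$ whenever $z\neq y$; (G4) $G$ is symmetric in all three variables (invariant under all permutations of its arguments); (G5) $G(x,y,z)\leq G(x,a,a)+G(a,y,z)$ for all $x,y,z,a\in X$. $(X,G)$ is symmetric if $G(x,y,y)=G(x,x,y)$ for all $x,y\in X$. A sequence $(x_n)$ in $X$ $G$-converges to $x\in X$ if $\lim_{n,m\to\infty}G(x,x_n,x_m)=0$ (equivalently, $\lim_{n\to\infty}G(x,x_n,x_n)=0$). A sequence $(x_n)$ is $G$-Cauchy if for each $\varepsilon>0$ there is $N\in\mathbb{N}$ with $G(x_n,x_m,x_m)<\varepsilon$ for all $m,n\geq N$. $(X,G)$ is $G$-complete if every $G$-Cauchy sequence in $X$ $G$-converges to an element of $X$. A mapping $T:X\to X$ is orbitally continuous if, for every $x\in X$ and every strictly increasing sequence $(n_i)$ of positive integers, whenever $T^{n_i}x$ $G$-converges to some $x^*\in X$ as $i\to\infty$, the sequence $T(T^{n_i}x)$ $G$-converges to $Tx^*$. *)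

(* Defs.v *)
From mathcomp Require Import all_boot all_order all_algebra.
From mathcomp Require Import boolp classical_sets reals topology normedtype.
From mathcomp Require Import sequences.

Set Implicit Arguments.
Unset Strict Implicit.
Unset Printing Implicit Defensive.

Import Order.TTheory GRing.Theory Num.Theory.
Import numFieldNormedType.Exports.

Local Open Scope classical_set_scope.
Local Open Scope ring_scope.

Section GMetric.
Context {R : realType} {X : Type}.
Implicit Types (G : X -> X -> X -> R) (T : X -> X) (u : nat -> X).

Record gmetric_space G : Prop := GMetricSpace {
  gmetric_inhabited : inhabited X;
  gmetric_ge0 : forall x y z, 0 <= G x y z;
  gmetric_diag : forall x y z, x = y -> y = z -> G x y z = 0;
  gmetric_gt0 : forall x y, x <> y -> 0 < G x x y;
  gmetric_le : forall x y z, z <> y -> G x x y <= G x y z;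
  (* one equation for each non-identity permutation *)
  gmetric_perm : forall x y z,
    [/\ G x y z = G x z y, G x y z = G y x z, G x y z = G y z x,
        G x y z = G z x y & G x y z = G z y x];
  gmetric_triangle : forall x y z a, G x y z <= G x a a + G a y z
}.

Definition gsymmetric G : Prop := forall x y, G x y y = G x x y.

(* (\oo, \oo) is the product filter: n and m tend to infinity jointly. *)
Definition gconverges G u (x : X) : Prop :=
  (fun nm : nat * nat => G x (u nm.1) (u nm.2)) @ (\oo, \oo) --> (0 : R).

Definition gcauchy G u : Prop :=
  forall eps : R, 0 < eps -> exists N : nat,
    forall n m : nat, (N <= m)%N -> (N <= n)%N -> G (u n) (u m) (u m) < eps.

Definition gcomplete G : Prop :=
  forall u, gcauchy G u -> exists x, gconverges G u x.

Definition orbitally_continuous G T : Prop :=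
  forall (x : X) (n : nat -> nat),
    (forall i, 0 < n i)%N -> {homo n : i j / (i < j)%N} ->
    forall xs : X,
      gconverges G (fun i => iter (n i) T x) xs ->
      gconverges G (fun i => T (iter (n i) T x)) (T xs).

End GMetric.

(* Main.v *)
Require Import Defs.
From mathcomp Require Import all_boot all_order all_algebra.
From mathcomp Require Import boolp classical_sets reals topology normedtype.
From mathcomp Require Import sequences.
From mathcomp Require Import ring lra.

Import Order.TTheory GRing.Theory Num.Theory.
Import numFieldNormedType.Exports.

Local Open Scope ring_scope.

(** Writing d(x, y) = G(x, y, y), the contractive inequality at (x, Tx, Tx)
    loses its a5 and a7 terms (they carry the factor G(Tx, Tx, Tx) = 0) and the
    two fractions cancel, leaving
      d(Tx, TTx) <= p d(x, Tx) + q d(Tx, TTx)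
    with p = a1 + a2 + 2 a3 + a6, q = 2 a2 + 2 a3 + a4 and p + q <= lambda1 < 1.
    So every orbit has geometrically decreasing steps, hence converges, and
    orbital continuity makes its limit a fixed point. *)

Section GMetricTheory.
Set Implicit Arguments.
Unset Strict Implicit.
Context {R : realType} {X : Type}.
Implicit Types (G : X -> X -> X -> R) (u : nat -> X).

Lemma gsymmetric_swap G x y :
  gmetric_space G -> gsymmetric G -> G x y y = G y x x.
Proof.
by move=> hG hsym; rewrite hsym; have [_ _ _ ->] := gmetric_perm hG x x y.
Qed.

Lemma gconvergesP G u x : gmetric_space G -> gconverges G u x <->
  forall e, 0 < e ->
  exists N, forall n m, (N <= n)%N -> (N <= m)%N -> G x (u n) (u m) < e.
Proof.
move=> hG; have normG n m : `|0 - G x (u n) (u m)| = G x (u n) (u m).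
  by rewrite sub0r normrN ger0_norm ?(gmetric_ge0 hG).
split=> [/cvgrPdist_lt ux e e0|ux].
  have [[A B] /= [[N1 _ hN1] [N2 _ hN2]] AB] := ux e e0.
  exists (maxn N1 N2) => n m; rewrite !geq_max => /andP[n1 _] /andP[_ m2].
  by rewrite -normG; exact: AB (n, m) (conj (hN1 n n1) (hN2 m m2)).
apply/cvgrPdist_lt => e /ux [N hN].
exists ([set n | (N <= n)%N], [set n | (N <= n)%N])%classic.
  by split; exists N.
by move=> [n m] [/= Nn Nm]; rewrite normG; exact: hN.
Qed.

Lemma gconverges_shift G u x : gmetric_space G ->
  gconverges G u x -> gconverges G (fun n => u n.+1) x.
Proof.
move=> hG /(gconvergesP _ _ hG) ux; apply/(gconvergesP _ _ hG) => e /ux [N hN].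
by exists N => n m Nn Nm; apply: hN; exact: leqW.
Qed.

(** Symmetry turns [G (u n) y y] into [G y (u n) (u n)], so the triangle inequality through [u n]
    bounds the distance from [x] to [y] by two terms, each less than half of it for large [n]. *)
Lemma gconverges_unique G u x y : gmetric_space G -> gsymmetric G ->
  gconverges G u x -> gconverges G u y -> x = y.
Proof.
move=> hG hsym ux uy; apply: contrapT => xy.
have d0 := gmetric_gt0 hG xy.
have e0 : 0 < G x x y / 2 by lra.
have [N1 h1] := (gconvergesP _ _ hG).1 ux _ e0.
have [N2 h2] := (gconvergesP _ _ hG).1 uy _ e0.
pose n := maxn N1 N2.
have := h1 n n (leq_maxl _ _) (leq_maxl _ _).
have := h2 n n (leq_maxr _ _) (leq_maxr _ _).
rewrite (gsymmetric_swap _ _ hG hsym) hsym.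
have := gmetric_triangle hG x y y (u n).
rewrite !hsym; lra.
Qed.

Lemma gcauchy_geometric G u (k : R) : gmetric_space G -> gsymmetric G ->
  0 <= k < 1 ->
  (forall n, G (u n.+1) (u n.+2) (u n.+2) <= k * G (u n) (u n.+1) (u n.+1)) ->
  gcauchy G u.
Proof.
move=> hG hsym /andP[k0 k1] uk.
set d0 := G (u 0%N) (u 1%N) (u 1%N).
have step n : G (u n) (u n.+1) (u n.+1) <= k ^+ n * d0.
  elim: n => [|n IHn]; first by rewrite expr0 mul1r.
  by apply: le_trans (uk n) _; rewrite exprS -mulrA ler_wpM2l.
(* [C] is the sum of the geometric series with first term [d0] and ratio [k]. The identity [CE]
   splits off its first term, which makes the bound in [far] independent of [j] and stable under
   induction on [j]. *)
pose C := d0 / (1 - k).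
have CE : d0 + C * k = C by rewrite /C; field; rewrite gt_eqF ?subr_gt0.
have C0 : 0 <= C by rewrite divr_ge0 ?(gmetric_ge0 hG) ?subr_ge0 ?ltW.
have far j n : G (u n) (u (n + j)%N) (u (n + j)%N) <= k ^+ n * C.
  elim: j n => [|j IHj] n.
    rewrite addn0 (gmetric_diag hG) //; exact: mulr_ge0 (exprn_ge0 _ k0) C0.
  apply: le_trans (gmetric_triangle hG _ _ _ (u n.+1)) _.
  apply: le_trans (lerD (step n) _) (_ : k ^+ n * d0 + k ^+ n.+1 * C <= _).
    by rewrite addnS -addSn; exact: IHj.
  by rewrite exprSr -mulrA -mulrDr (mulrC k) CE.
move=> e e0.
have kC : ((fun n => k ^+ n * C) @ \oo --> (0 : R))%classic.
  rewrite -(mul0r C); apply: cvgMl.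
  by apply: cvg_expr; rewrite ger0_norm.
have /cvgrPdist_lt /(_ e e0) [N _ hN] := kC.
have small n j : (N <= n)%N -> G (u n) (u (n + j)%N) (u (n + j)%N) < e.
  move=> /hN /=; rewrite sub0r normrN => /(le_lt_trans (ler_norm _)).
  exact: le_lt_trans (far j n).
(* [small] only looks forward from the first index; symmetry of [G] exchanges the indices when
   [m < n]. *)
exists N => n m Nm Nn; have [nm|/ltnW mn] := leqP n m.
  by rewrite -(subnKC nm) small.
by rewrite (gsymmetric_swap _ _ hG hsym) -(subnKC mn) small.
Qed.

End GMetricTheory.

Theorem theorem2p6 (R : realType) (X : Type) (G : X -> X -> X -> R)
    (T : X -> X) (a1 a2 a3 a4 a5 a6 a7 : X -> X -> X -> R) (lambda1 : R)
    (hG : gmetric_space G) (hsym : gsymmetric G) (hcomp : gcomplete G)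
    (hT : orbitally_continuous G T)
    (ha1 : forall x y z, 0 <= a1 x y z) (ha2 : forall x y z, 0 <= a2 x y z)
    (ha3 : forall x y z, 0 <= a3 x y z) (ha4 : forall x y z, 0 <= a4 x y z)
    (ha5 : forall x y z, 0 <= a5 x y z) (ha6 : forall x y z, 0 <= a6 x y z)
    (ha7 : forall x y z, 0 <= a7 x y z)
    (hlambda0 : 0 < lambda1) (hlambda1 : lambda1 < 1)
    (hsum : forall x y z,
      a1 x y z + 3 * a2 x y z + 4 * a3 x y z + a4 x y z + a6 x y z <= lambda1)
    (hcontr : forall x y z,
      G (T x) (T y) (T z) <=
        a1 x y z * G x y z
        + a2 x y z * (G x (T x) (T x) + G y (T y) (T y) + G z (T z) (T z))
        + a3 x y z * (G (T x) y z + G x (T y) z + G x y (T z))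
        + a4 x y z * Num.min (G y (T y) (T y)) (G z (T z) (T z))
            * ((1 + G x (T x) (T x)) / (1 + G x y z))
        + a5 x y z * G (T x) y z * (1 + G x (T y) z + G x y (T z))
            * (1 + G x y z)^-1
        + a6 x y z * G x y z * (1 + G x (T x) (T x) + G (T x) y z)
            * (1 + G x y z)^-1
        + a7 x y z * G (T x) y z) :
  exists x : X, T x = x.
Proof.
have step x : G (T x) (T (T x)) (T (T x)) <= lambda1 * G x (T x) (T x).
  have := hcontr x (T x) (T x); have := hsum x (T x) (T x).
  move: (ha1 x (T x) (T x)) (ha2 x (T x) (T x)) (ha3 x (T x) (T x))
    (ha4 x (T x) (T x)) (ha6 x (T x) (T x)).
  rewrite (gmetric_diag hG (erefl (T x)) (erefl (T x))) minxx !mulr0 !mul0r.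
  (* The two surviving [a3] terms are permutations of one value [g], and the triangle inequality
     through [T x] gives [g <= d0 + d1], using symmetry for [d1]. *)
  have [-> _ _ _ _] := gmetric_perm hG x (T x) (T (T x)).
  have := gmetric_triangle hG x (T (T x)) (T x) (T x).
  have [-> _ _ _ _] := gmetric_perm hG (T x) (T (T x)) (T x).
  rewrite -(hsym (T x)).
  have := gmetric_ge0 hG x (T x) (T x).
  have := gmetric_ge0 hG (T x) (T (T x)) (T (T x)).
  set d0 := G x (T x) (T x); set d1 := G (T x) _ _; set g := G x (T (T x)) _.
  set b1 := a1 _ _ _; set b2 := a2 _ _ _; set b3 := a3 _ _ _.
  set b4 := a4 _ _ _; set b6 := a6 _ _ _.
  move=> d1_ge0 d0_ge0 gle b1_ge0 b2_ge0 b3_ge0 b4_ge0 b6_ge0 hb.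
  have d0_neq0 : 1 + d0 != 0 by rewrite gt_eqF // ltr_pwDl.
  rewrite !addr0 add0r divff // mulr1 mulfK // => hd.
  pose p := b1 + b2 + 2 * b3 + b6; pose q := 2 * b2 + 2 * b3 + b4.
  have hb3 : b3 * (g + g) <= b3 * (2 * (d0 + d1)).
    by apply: ler_wpM2l => //; lra.
  have hpq : d1 <= p * d0 + q * d1 by rewrite /p /q; nra.
  have q_ge0 : 0 <= q by rewrite /q; lra.
  have pq : p + q <= lambda1 by rewrite /p /q; lra.
  have p_ge0 : 0 <= p by rewrite /p; lra.
  have q_lt1 : 0 < 1 - q by lra.
  (* The natural ratio is [p / (1 - q)]. It is at most [lambda1] because [p <= lambda1 - q <=
     lambda1 - q * lambda1]. *)
  rewrite -(ler_pM2l q_lt1).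
  have ple : p <= (1 - q) * lambda1 by nra.
  have := ler_wpM2r d0_ge0 ple; lra.
have [x0] := gmetric_inhabited hG.
(* The orbit starts at [T x0] because orbital continuity concerns positive exponents only. *)
pose u n := iter n.+1 T x0.
have [x ux] : exists x, gconverges G u x.
  by apply/hcomp/(gcauchy_geometric hG hsym (k := lambda1)) => [|n];
    [rewrite ltW | exact: step].
have Tux := hT x0 succn (fun=> isT) (fun _ _ => id) x ux.
exists x.
(* Applying [T] along [u] gives [u] shifted by one, which therefore tends to both [T x] and [x]. *)
exact: (gconverges_unique hG hsym Tux (gconverges_shift hG ux)).
Qed.
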